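(* Let $S$ be a symmetric numerical semigroup. Then $\dim_{\mathrm{mat}} S = m(S)$. In particular, if $S$ is a numerical semigroup with embedding dimension $e(S) = 2$, then $\dim_{\mathrm{mat}} S = m(S)$.
   Context: $\mathbb{N} = \{0,1,2,\ldots\}$. $\mathrm{M}_d(\mathbb{Z})$ and $\mathrm{M}_d(\mathbb{Q})$ denote the sets of $d \times d$ matrices with entries in $\mathbb{Z}$ and $\mathbb{Q}$, respectively. For $A \in \mathrm{M}_d(\mathbb{Q})$, the exponent semigroup of $A$ is $\mathcal{S}(A) = \{ n \in \mathbb{N} : A^n \in \mathrm{M}_d(\mathbb{Z})\}$ (with $A^0 = I$). A numerical semigroup is an additive subsemigroup $S$ of $\mathbb{N}$, containing $0$, with finite complement $\mathbb{N} \setminus S$. Each numerical semigroup has a unique minimal system of generators, i.e. positive integers $n_1 < n_2 < \cdots < n_k$ such that $S = \langle n_1, \ldots, n_k\rangle$ is the smallest additive subsemigroup of $\mathbb{N}$ (containing $0$) that contains $n_1,\ldots,n_k$, with no generator redundant; the embedding dimension is $e(S) = k$ and the multiplicity is $m(S) = n_1$, the smallest positive element of $S$. The conductor is $c(S) = 1 + \max(\mathbb{N} \setminus S)$ (with the convention $c(\mathbb{N}) = 0$). Put $F = c(S) - 1$. $S$ is symmetric if, for every $x \in \mathbb{Z} \setminus S$, one has $F - x \in S$. The matricial dimension of $S$ is $\dim_{\mathrm{mat}} S = \min\{ d \geq 1 : \text{there is an } A \in \mathrm{M}_d(\mathbb{Q}) \text{ such that } S = \mathcal{S}(A)\}$;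 it is known that every numerical semigroup is an exponent semigroup of some rational matrix, so this minimum exists. *)

(* Defs.v *)
From mathcomp Require Import all_boot all_order all_algebra.
From mathcomp Require Import finmap boolp classical_sets cardinality.

Set Implicit Arguments.
Unset Strict Implicit.
Unset Printing Implicit Defensive.

Import Order.TTheory GRing.Theory Num.Theory.

Local Open Scope classical_set_scope.

(* The least element of [A]; the default value is 0 when [A] is empty. *)
Definition nat_min (A : set nat) : nat :=
  xget 0 [set m | A m /\ forall n, A n -> m <= n].

Definition submonoid (S : set nat) : Prop :=
  S 0 /\ forall x y, S x -> S y -> S (x + y).

Definition numerical_semigroup (S : set nat) : Prop :=
  submonoid S /\ finite_set (~` S).

Definition generated (G : set nat) : set nat := smallest submonoid G.

Definition minimal_generating_system (S : set nat) (s : seq nat) : Prop :=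
  [/\ sorted ltn s, {in s, forall x, 0 < x}, generated [set` s] = S
    & {in s, forall x, generated ([set` s] `\ x) <> S}].

Definition minimal_generators (S : set nat) : seq nat :=
  xget [::] [set s | minimal_generating_system S s].

Definition embedding_dim (S : set nat) : nat := size (minimal_generators S).

Definition multiplicity (S : set nat) : nat :=
  nat_min [set n | S n /\ 0 < n].

(* The maximum of [x + 1] over the gaps [x], so that the conductor of the set
   of all natural numbers, which has no gap, is 0. Meaningful
   only when the complement of [S] is finite: [fset_set] of an infinite set is
   empty. *)
Definition conductor (S : set nat) : nat :=
  \max_(x <- fset_set (~` S)) x.+1.

(* The Frobenius number is an integer: it is -1 when there is no gap. *)
Definition frobenius (S : set nat) : int := ((conductor S)%:Z - 1)%R.

Definition symmetric_semigroup (S : set nat) : Prop :=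
  forall x : int, ~ (Posz @` S) x -> (Posz @` S) (frobenius S - x)%R.

Definition exponent_semigroup (d : nat) (A : 'M[rat]_d) : set nat :=
  [set n | (A ^+ n)%R \is a mxOver Num.int].

Definition mat_dim (S : set nat) : nat :=
  nat_min [set d | 0 < d /\ exists A : 'M[rat]_d, S = exponent_semigroup A].

(* Main.v *)
(* Lower bound: if [A] is a rational [d x d] matrix with [A ^+ n] integral for some [n > 0],
   its minimal polynomial is monic with integer coefficients (Gauss's lemma), so [A]
   satisfies an integral linear recurrence of order at most [d] and [d] consecutive exponents
   in [S] force the next one to be in [S]. When [S] is symmetric with multiplicity [m] and
   Frobenius number [F], the gaps [1, ..., m - 1] reflect to [F - m + 1, ..., F - 1] in [S]
   while [F] is not in [S]; hence [d >= m].
   Upper bound: let [w j] be the least element of [S] congruent to [j] mod [m], and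
   [h j = (j - w j) / m]. Then [h] is superadditive, [h (j + m) = h j + 1], and [j] is in [S]
   iff [h j >= 0]. The [m]-cycle with weights [2 ^ (h (i + 1) - h i)] has as nonzero entries
   of its [n]-th power the numbers [2 ^ (h (i + n) - h i)], which are all integers iff [n] is
   in [S]. *)
Require Import Defs.
From mathcomp Require Import all_boot all_order all_algebra.
From mathcomp Require Import boolp classical_sets cardinality.
From mathcomp Require Import zify ring.

Set Implicit Arguments.
Unset Strict Implicit.
Unset Printing Implicit Defensive.

Import Order.TTheory GRing.Theory Num.Theory.

Local Open Scope classical_set_scope.

(** * Least elements of sets of natural numbers *)

Lemma nat_minP (A : set nat) : A !=set0 ->
  A (nat_min A) /\ forall n, A n -> nat_min A <= n.
Proof.
case=> n An; rewrite /nat_min.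
have exA : exists m, `[< A m >] by exists n; apply/asboolP.
case: (ex_minnP exA) => m /asboolP Am mP.
apply: (@xgetPex _ 0 [set m | A m /\ forall n, A n -> m <= n]).
exists m; split=> // k Ak; exact/mP/asboolP.
Qed.

Lemma nat_min_eq (A : set nat) m :
  A m -> (forall n, A n -> m <= n) -> nat_min A = m.
Proof.
move=> Am mP; have [AM MP] := @nat_minP A (ex_intro _ m Am).
by apply/eqP; rewrite eqn_leq MP // mP.
Qed.

(** * Integral recurrences for powers of a rational matrix *)

Section IntegralPowers.
Local Open Scope ring_scope.

Local Notation pZtoQ := (map_poly (intr : int -> rat)).

Lemma horner_mx_sum (R : comNzRingType) k (A : 'M[R]_k.+1) (p : {poly R}) :
  horner_mx A p = \sum_(i < size p) p`_i *: A ^+ i.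
Proof.
rewrite -{1}[p]coefK poly_def linear_sum /=; apply: eq_bigr => i _.
by rewrite linearZ /= rmorphXn /= horner_mx_X.
Qed.

Lemma horner_mx_comp_Xn (R : comNzRingType) k (A : 'M[R]_k.+1) (p : {poly R}) n :
  horner_mx A (p \Po 'X^n) = horner_mx (A ^+ n) p.
Proof.
rewrite comp_polyE linear_sum horner_mx_sum /=; apply: eq_bigr => i _.
by rewrite linearZ /= !rmorphXn /= horner_mx_X.
Qed.

Lemma mxOver_int_map n (B : 'M[rat]_n) :
  B \is a mxOver Num.int -> exists C : 'M[int]_n, B = map_mx intr C.
Proof.
move=> /mxOverP BZ; exists (map_mx Num.floor B).
by apply/matrixP => i j; rewrite !mxE floorK.
Qed.

(** If [C] is the integral matrix [A ^+ n], then [char_poly C \Po 'X^n] is monic, integral and kills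
    [A]. The minimal polynomial of [A] divides it, so by Gauss's lemma it is proportional to an
    integral factor [p], whose leading coefficient is invertible in [int]. *)
Lemma monic_int_annihilator k (A : 'M[rat]_k.+1) n :
    (0 < n)%N -> A ^+ n \is a mxOver Num.int ->
  exists p : {poly int},
    [/\ p \is monic, (size p <= k.+2)%N & horner_mx A (pZtoQ p) = 0].
Proof.
move=> n_gt0 /mxOver_int_map[C defC].
pose q := char_poly C \Po 'X^n.
have q_monic : q \is monic.
  apply/monicP; rewrite lead_coef_comp ?size_polyXn //.
  by rewrite (monicP (char_poly_monic C)) lead_coefXn expr1n mulr1.
have qA0 : horner_mx A (pZtoQ q) = 0.
  rewrite map_comp_poly map_polyXn horner_mx_comp_Xn map_char_poly -defC.
  exact: Cayley_Hamilton.
have [p [a a_neq0 def_minp] [r def_q]] := dvdpP_rat_int (mxminpoly_min qA0).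
have lc1 : lead_coef p * lead_coef r = 1.
  by rewrite -lead_coefM -def_q (monicP q_monic).
have lcU : lead_coef p \is a GRing.unit.
  by apply/unitrPr; exists (lead_coef r).
have pA0 : horner_mx A (pZtoQ p) = 0.
  have /eqP := mx_root_minpoly A; rewrite def_minp linearZ scaler_eq0 /=.
  by rewrite (negPf a_neq0) => /eqP.
exists (lead_coef r *: p); split.
- by apply/monicP; rewrite lead_coefZ mulrC.
- have r_neq0 : lead_coef r != 0.
    by apply: contra_eq_neq lc1 => ->; rewrite mulr0 eq_sym oner_neq0.
  rewrite size_scale //.
  have -> : size p = size (mxminpoly A).
    by rewrite def_minp size_scale // size_map_poly_id0 // intr_eq0 lead_coef_eq0;
       apply: contra_eq_neq lc1 => ->; rewrite lead_coef0 mul0r eq_sym oner_neq0.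
  rewrite -(size_char_poly A) dvdp_leq ?mxminpoly_dvd_char //.
  exact: monic_neq0 (char_poly_monic A).
- by rewrite map_polyZ linearZ /= pA0 scaler0.
Qed.

Lemma exponent_semigroup_run d (A : 'M[rat]_d) n0 n :
    (0 < d)%N -> (0 < n0)%N -> exponent_semigroup A n0 ->
    (forall i, (i < d)%N -> exponent_semigroup A (n + i)%N) ->
  exponent_semigroup A (n + d)%N.
Proof.
case: d A => // k A _ n0_gt0 An0 run.
have [p [p_monic size_p pA0]] := monic_int_annihilator n0_gt0 An0.
have size_p_gt0 : (0 < size p)%N by rewrite size_poly_gt0 monic_neq0.
(* The recurrence has order [e], possibly below [k.+1]; starting at [n'] makes it use only the last
   [e] exponents of the run. *)
pose e := (size p).-1; pose n' := (n + (k.+1 - e))%N.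
have sz : size (pZtoQ p) = e.+1.
  by rewrite size_map_poly_id0 ?prednK // (monicP p_monic) oner_neq0.
have lc : (pZtoQ p)`_e = 1.
  by rewrite coef_map /= -lead_coefE (monicP p_monic).
move: pA0; rewrite horner_mx_sum sz big_ord_recr /= lc scale1r => /eqP.
rewrite addrC addr_eq0 => /eqP defAe.
have -> : (n + k.+1 = n' + e)%N by rewrite /n' /e; lia.
change (A ^+ (n' + e) \is a mxOver Num.int).
rewrite exprD defAe mulrN mulr_sumr; apply/mxOverP => u v.
rewrite mxE rpredN summxE rpred_sum // => i _.
rewrite -scalerAr -exprD coef_map mxE rpredM ?intr_int //=.
apply/mxOverP; have := run ((k.+1 - e) + i)%N; rewrite addnA; apply.
by have := ltn_ord i; rewrite /e in i *; lia.
Qed.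

End IntegralPowers.

(** * Conductor, multiplicity and the lower bound *)

Lemma image_Posz (S : set nat) n : (Posz @` S) (Posz n) <-> S n.
Proof. by split=> [[k Sk [<-]] //|Sn]; exists n. Qed.

Lemma conductor_leq (S : set nat) n :
  finite_set (~` S) -> conductor S <= n -> S n.
Proof.
move=> finS; apply: contraPP => nSn; apply/negP; rewrite -ltnNge.
by apply: (@leq_bigmax_seq _ _ _ succn n) => //; rewrite in_fset_set ?inE.
Qed.

Lemma pred_conductor_notin (S : set nat) :
  finite_set (~` S) -> 0 < conductor S -> ~ S (conductor S).-1.
Proof.
move=> finS c_gt0 Sc.
have : conductor S <= (conductor S).-1.
  apply/bigmax_leqP_seq => x x_gap _.
  have x_lt : x < conductor S by apply: (@leq_bigmax_seq _ _ _ succn x).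
  rewrite in_fset_set ?inE // in x_gap.
  have : x != (conductor S).-1 by apply/eqP => x_eq; apply: x_gap; rewrite x_eq.
  by move/eqP: x_lt c_gt0; lia.
by rewrite leqNgt prednK // leqnn.
Qed.

(** Taking [f] in [int] covers the value -1, reached when there is no gap. *)
Lemma frobenius_eq (S : set nat) (f : int) : finite_set (~` S) ->
    ~ (Posz @` S) f -> (forall x, (f < x)%R -> (Posz @` S) x) ->
  frobenius S = f.
Proof.
move=> finS nSf Sgt; rewrite /frobenius; set c := conductor S.
have [f_lt|lt_f|->] // := ltgtP (c%:Z - 1)%R f.
  have [n def_f] : exists n, f = Posz n by exists `|f|%N; lia.
  by case: nSf; rewrite def_f image_Posz; apply: conductor_leq => //; lia.
have := Sgt _ lt_f; have [->|c_gt0] := posnP c; first by case=> n _ /eqP; lia.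
have -> : (c%:Z - 1 = c.-1%:Z)%R by lia.
by rewrite image_Posz => /(pred_conductor_notin finS c_gt0).
Qed.

Lemma multiplicityP (S : set nat) : numerical_semigroup S ->
  [/\ S (multiplicity S), 0 < multiplicity S
    & forall n, S n -> 0 < n -> multiplicity S <= n].
Proof.
case=> _ finS.
have ne : [set n | S n /\ 0 < n] !=set0.
  by exists (conductor S).+1; split=> //=; apply: conductor_leq.
by have [[Sm m_gt0] mP] := nat_minP ne; split=> // n Sn n_gt0; apply: mP.
Qed.

Lemma symmetric_multiplicity_leq d (A : 'M[rat]_d) :
    let S := exponent_semigroup A in
    0 < d -> numerical_semigroup S -> symmetric_semigroup S ->
  multiplicity S <= d.
Proof.
move=> S d_gt0 numS symS; have [Sm m_gt0 mP] := multiplicityP numS.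
have finS := numS.2; set m := multiplicity S in Sm m_gt0 mP *.
rewrite leqNgt; apply/negP => d_lt_m.
have gap x : 0 < x -> x < m -> ~ S x.
  by move=> x_gt0 x_lt Sx; have := mP x Sx x_gt0; lia.
pose c := conductor S.
(* Since [0 < d < m], the number [m.-1] is a positive gap. *)
have m_le_c : m <= c.
  rewrite leqNgt; apply/negP => c_lt.
  by apply: (gap m.-1); [lia | lia | apply: conductor_leq => //; rewrite -/c; lia].
apply: (@pred_conductor_notin S finS); first by rewrite -/c; lia.
rewrite -/c (_ : c.-1 = (c.-1 - d) + d); last by lia.
apply: (exponent_semigroup_run d_gt0 m_gt0 Sm) => i i_lt.
apply/image_Posz.
(* The run just below the Frobenius number mirrors the gaps [d - i], which lie between 1 and
   [d < m]. *)
rewrite (_ : Posz _ = frobenius S - (d - i)%:Z)%R; last by rewrite /frobenius -/c; lia.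
by apply: symS; rewrite image_Posz; apply: gap; lia.
Qed.

(** * Semigroups with two generators *)

(* [x = i a + j b] with [0 <= i < b] lies in the semigroup exactly when [0 <= j], and
   [x |-> (a b - a - b) - x] sends [(i, j)] to [(b - 1 - i, - 1 - j)]. *)
Lemma symmetric_two_generators a b (S : set nat) :
    0 < a -> 0 < b -> coprime a b -> finite_set (~` S) ->
    (forall n, S n <-> exists i j, n = i * a + j * b) ->
  symmetric_semigroup S.
Proof.
move=> a_gt0 b_gt0 co_ab finS SP.
have decomp (x : int) : exists (i : nat) (j : int),
    i < b /\ x = (i%:Z * a%:Z + j * b%:Z)%R.
  have [u [v uv1]] := Bezoutz a b.
  have {}uv1 : (u * a%:Z + v * b%:Z = 1)%R.
    by rewrite uv1 /gcdz /= (eqP co_ab).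
  (* Reduce the Bezout coefficient [x * u] of [a] modulo [b] and move the quotient to the
     coefficient of [b]. *)
  exists `|(x * u %% b)%Z|%N, (x * v + (x * u %/ b)%Z * a%:Z)%R.
  have ge0 : (0 <= (x * u %% b)%Z)%R by apply: modz_ge0; lia.
  have lt_b : ((x * u %% b)%Z < b%:Z)%R by apply: ltz_pmod; lia.
  rewrite gez0_abs //; split; first by lia.
  rewrite -{1}[x]mulr1 -uv1 mulrDr !mulrA {1}(divz_eq (x * u) b).
  ring.
have ge0_S i (j : int) : (0 <= j)%R -> (Posz @` S) (i%:Z * a%:Z + j * b%:Z)%R.
  case: j => // j _; rewrite -!PoszM -PoszD image_Posz SP.
  by exists i, j.
have lt0_S i (j : int) : (i < b) -> (j < 0)%R ->
    ~ (Posz @` S) (i%:Z * a%:Z + j * b%:Z)%R.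
  move=> i_lt j_lt [n /SP[k [l ->]] eq_kl].
  have /dvdzP[t def_t] : (b %| (k%:Z - i%:Z)%R)%Z.
    rewrite -(@Gauss_dvdzl _ _ a%:Z) ?coprimezE 1?coprime_sym //.
    by apply/dvdzP; exists (j - l%:Z)%R; lia.
  (* As [k - i = t * b > - b], [t] is nonnegative, whence [l <= j < 0], which is absurd. *)
  have : (t * a%:Z = j - l%:Z)%R by nia.
  have : (0 <= t)%R by nia.
  nia.
pose f : int := (b%:Z * a%:Z - a%:Z - b%:Z)%R.
have f_sym x : ~ (Posz @` S) x -> (Posz @` S) (f - x)%R.
  have [i [j [i_lt ->]]] := decomp x.
  have [j_ge0|j_lt0] := leP 0%R j; first by move/(_ (ge0_S i j j_ge0)).
  move=> _; rewrite (_ : _ - _ = (b.-1 - i)%:Z * a%:Z + (- 1 - j) * b%:Z)%R.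
    by apply: ge0_S; lia.
  by rewrite /f; nia.
have nSf : ~ (Posz @` S) f.
  rewrite (_ : f = b.-1%:Z * a%:Z + (- 1) * b%:Z)%R; last by rewrite /f; nia.
  by apply: lt0_S; lia.
have frobS : frobenius S = f.
  (* A gap above [f] would reflect to a negative element of [S]. *)
  apply: frobenius_eq => // x f_lt; apply: contrapT => /f_sym[n _]; lia.
by rewrite /symmetric_semigroup frobS.
Qed.

Lemma generated_pairE a b n :
  generated [set` [:: a; b]] n <-> exists i j, n = i * a + j * b.
Proof.
have sub : submonoid (generated [set` [:: a; b]]).
  split=> [G [[G0 _] _] //|x y Sx Sy G GP].
  by apply: GP.1.2; [apply: Sx | apply: Sy].
have mulS x k : generated [set` [:: a; b]] x -> generated [set` [:: a; b]] (k * x).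
  move=> Sx; elim: k => [|k IHk]; first exact: sub.1.
  by rewrite mulSn; apply: sub.2.
split=> [|[i [j ->]]].
- move=> gen_n; apply: (gen_n [set n | exists i j, n = i * a + j * b]).
  split=> [|x /=]; last first.
    by rewrite !inE => /orP[]/eqP->; [exists 1, 0 | exists 0, 1]; lia.
  split=> [|_ _ [i [j ->]] [k [l ->]]]; first by exists 0, 0.
  by exists (i + k), (j + l); lia.
- by apply: sub.2; apply: mulS => G [_ GG]; apply: GG; rewrite /= !inE eqxx ?orbT.
Qed.

Lemma embedding_dim2_symmetric (S : set nat) :
  numerical_semigroup S -> embedding_dim S = 2 -> symmetric_semigroup S.
Proof.
move=> [_ finS]; rewrite /embedding_dim /minimal_generators.
(* The default [[::]] has size 0, so a generating system was really chosen. *)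
case: xgetP => [s _ [_ s_gt0 genS _]|] // size_s.
move: s size_s s_gt0 genS => [|a [|b []]] // _ s_gt0 genS.
have a_gt0 : 0 < a by apply: s_gt0; rewrite inE eqxx.
have b_gt0 : 0 < b by apply: s_gt0; rewrite !inE eqxx orbT.
have SP n : S n <-> exists i j, n = i * a + j * b.
  by rewrite -genS; exact: generated_pairE.
apply: (symmetric_two_generators a_gt0 b_gt0) => //.
pose g := gcdn a b.
have g_dvd n : S n -> g %| n.
  move=> /SP[i [j ->]]; apply: dvdn_add; apply: dvdn_mull.
    exact: dvdn_gcdl.
  exact: dvdn_gcdr.
(* The gcd divides two consecutive elements of [S], hence is 1. *)
have Sc := conductor_leq finS (leqnn (conductor S)).
have Sc1 := conductor_leq finS (leqnSn (conductor S)).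
by have := g_dvd _ Sc1; rewrite -addn1 (dvdn_addr _ (g_dvd _ Sc)) dvdn1.
Qed.

(** * Powers of a weighted cycle *)

Section WeightedCycle.
Local Open Scope ring_scope.

Variables (k : nat) (h : nat -> int).
Hypothesis h_period : forall j, h (j + k.+1)%N = h j + 1.

(** The index in [h i.+1] is not reduced: by [h_period] the last row gains a factor 2. This is a
    companion matrix of [X^(k+1) - 2] conjugated by the diagonal matrix of the [2 ^ h i]. *)
Definition weighted_cycle : 'M[rat]_k.+1 :=
  \matrix_(i, j) (2%:R ^ (h i.+1 - h i) *+ (j == i.+1 %[mod k.+1])).

Lemma periodM j q : h (j + q * k.+1)%N = h j + q%:Z.
Proof.
elim: q => [|q IHq]; first by rewrite mul0n addn0 addr0.
by rewrite mulSn addnCA addnC h_period IHq -addrA -PoszD addn1.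
Qed.

(** A single path of length [n] leaves [i], and the exponents along it telescope. *)
Lemma weighted_cycle_exp n (i j : 'I_k.+1) :
  (weighted_cycle ^+ n) i j =
    2%:R ^ (h (i + n)%N - h i) *+ (j == i + n %[mod k.+1]).
Proof.
elim: n j => [|n IHn] j.
  by rewrite expr0 mxE addn0 subrr expr0z !modn_small // eq_sym.
have l_lt : ((i + n) %% k.+1 < k.+1)%N by rewrite ltn_mod.
rewrite exprSr mxE (bigD1 (Ordinal l_lt)) //= big1 ?addr0 => [|l l_neq]; last first.
  rewrite IHn [_ == _ %[mod _]](_ : _ = false) ?mul0r // modn_small //.
  by apply: contraNF l_neq => /eqP l_eq; apply/eqP/val_inj.
rewrite IHn !mxE /= modn_mod eqxx mulr1n mulrnAr -expfzDr ?pnatr_eq0 //.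
rewrite -[in X in _ == X](addn1 (_ %% _)%N) modnDml addn1 -addnS; congr (_ ^ _ *+ _).
(* Reducing the index modulo [k.+1] shifts both values of [h] equally, so their difference is
   unchanged. *)
have := periodM ((i + n) %% k.+1)%N ((i + n) %/ k.+1)%N.
have := periodM ((i + n) %% k.+1)%N.+1 ((i + n) %/ k.+1)%N.
by rewrite addSn addnC -divn_eq addnS; lia.
Qed.

(** A negative power of 2 lies strictly between 0 and 1. *)
Lemma exp2z_int (z : int) : ((2%:R : rat) ^ z \is a Num.int) = (0 <= z).
Proof.
apply/idP/idP => [/intrP[m eq_m]|]; last by case: z => // n _; rewrite rpredX ?rpred_nat.
rewrite leNgt; apply/negP => z_lt0.
have : (0 : rat) < m%:~R by rewrite -eq_m exprz_gt0.
have : m%:~R < (1 : rat).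
  by rewrite -eq_m -(expr0z (2%:R : rat)) ltr_eXz2l.
by rewrite ltr0z ltrz1; lia.
Qed.

Lemma weighted_cycle_int n :
  (weighted_cycle ^+ n \is a mxOver Num.int) <->
    (forall i, (i < k.+1)%N -> h i <= h (i + n)%N).
Proof.
split=> [/mxOverP AnZ i i_lt|h_le].
  have j_lt : ((i + n) %% k.+1 < k.+1)%N by rewrite ltn_mod.
  have := AnZ (Ordinal i_lt) (Ordinal j_lt).
  by rewrite weighted_cycle_exp /= modn_mod eqxx mulr1n exp2z_int subr_ge0.
apply/mxOverP => i j; rewrite weighted_cycle_exp rpredMn // exp2z_int subr_ge0.
exact: h_le.
Qed.

End WeightedCycle.

(** * Apery set and the height function *)

Section Apery.

Variables (S : set nat) (m : nat).
Hypotheses (numS : numerical_semigroup S) (Sm : S m) (m_gt0 : 0 < m).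

Definition apery n := nat_min [set x | S x /\ x = n %[mod m]].

Lemma aperyP n : [/\ S (apery n), apery n = n %[mod m]
  & forall x, S x -> x = n %[mod m] -> apery n <= x].
Proof.
have ne : [set x | S x /\ x = n %[mod m]] !=set0.
  exists (n + conductor S * m); split; last by rewrite addnC modnMDl.
  by apply: (conductor_leq numS.2); nia.
by have [[? ?] mP] := nat_minP ne; split=> // x Sx x_mod; apply: mP.
Qed.

(** Both remainders modulo [m] agree, so this difference of quotients is exactly
    [(j - apery j) / m]. *)
Definition apery_height j : int := ((j %/ m)%:Z - (apery j %/ m)%:Z)%R.

Lemma mul_apery_height j : (m%:Z * apery_height j = j%:Z - (apery j)%:Z)%R.
Proof.
have [_ w_mod _] := aperyP j; rewrite /apery_height.
by have := divn_eq j m; have := divn_eq (apery j) m; rewrite w_mod; nia.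
Qed.

Lemma mem_apery_leq j : S j <-> apery j <= j.
Proof.
have [Sw w_mod w_min] := aperyP j; split=> [Sj|w_le]; first exact: w_min.
have /dvdnP[q def_q] : m %| j - apery j by rewrite -eqn_mod_dvd // w_mod.
rewrite -(subnK w_le) def_q; apply: numS.1.2 => //.
by elim: q {def_q} => [|q IHq]; [exact: numS.1.1 | apply: numS.1.2].
Qed.

Lemma apery_height_ge0 j : (0 <= apery_height j)%R <-> S j.
Proof. by rewrite mem_apery_leq; have := mul_apery_height j; split; nia. Qed.

(** [apery a + apery b] is an element of [S] in the class of [a + b], so it bounds
    [apery (a + b)]. *)
Lemma apery_heightD a b :
  (apery_height a + apery_height b <= apery_height (a + b))%R.
Proof.
have [[Sa a_mod _] [Sb b_mod _]] := (aperyP a, aperyP b).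
have [_ _ w_min] := aperyP (a + b).
have w_le : apery (a + b) <= apery a + apery b.
  by apply: w_min; [exact: numS.1.2 | rewrite -modnDm a_mod b_mod modnDm].
rewrite -(@ler_pM2l _ m%:Z) ?ltz_nat // mulrDr !mul_apery_height; lia.
Qed.

Lemma apery_height_period j : (apery_height (j + m) = apery_height j + 1)%R.
Proof.
rewrite /apery_height divnDr // divnn m_gt0.
have -> : apery (j + m) = apery j; last by lia.
by rewrite /apery modnDr.
Qed.

Lemma apery_height0 : apery_height 0 = 0%R.
Proof.
have : apery 0 <= 0 by rewrite -mem_apery_leq; exact: numS.1.1.
by rewrite /apery_height leqn0 => /eqP->; rewrite div0n subrr.
Qed.

End Apery.

(** * Upper bound and conclusion *)

Lemma exponent_semigroup_of_size (S : set nat) m :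
    numerical_semigroup S -> S m -> 0 < m ->
  exists A : 'M[rat]_m, S = exponent_semigroup A.
Proof.
case: m => // k numS Sm m_gt0; pose h := apery_height S k.+1.
exists (weighted_cycle k h); apply/seteqP.
have h_period j : h (j + k.+1) = (h j + 1)%R := apery_height_period S m_gt0 j.
split=> n; rewrite /exponent_semigroup /= weighted_cycle_int //.
  rewrite -(apery_height_ge0 numS Sm m_gt0) -/h => hn i _.
  (* Superadditivity gives [h i <= h i + h n <= h (i + n)]. *)
  by apply: le_trans (apery_heightD numS m_gt0 i n); rewrite lerDl.
(* Conversely, row 0 suffices, since [h 0 = 0]. *)
move/(_ 0 m_gt0); rewrite /h (apery_height0 numS Sm m_gt0) add0n.
by rewrite apery_height_ge0.
Qed.

Lemma mat_dim_symmetric (S : set nat) :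
    numerical_semigroup S -> symmetric_semigroup S ->
  mat_dim S = multiplicity S.
Proof.
move=> numS symS; have [Sm m_gt0 _] := multiplicityP numS.
apply: nat_min_eq => [|d [d_gt0 [A defS]]].
  by split; last exact: exponent_semigroup_of_size.
rewrite defS in numS symS *; exact: symmetric_multiplicity_leq.
Qed.

Theorem corollary4p2 :
  (forall S : set nat, numerical_semigroup S -> symmetric_semigroup S ->
     mat_dim S = multiplicity S) /\
  (forall S : set nat, numerical_semigroup S -> embedding_dim S = 2 ->
     mat_dim S = multiplicity S).
Proof.
split=> S numS; first exact: mat_dim_symmetric.
by move/(embedding_dim2_symmetric numS); apply: mat_dim_symmetric.
Qed.
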